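(* Let $C_1,\dots,C_k$ be concept classes over sets $X_1,\dots,X_k$ with $\emptyset\notin C_i$ for all $i$, where each $c_i^*\in C_i$ is learnable by an algorithm $A_i$ from $\#\mathrm{Mem}_i(c_i^* )$ membership queries. Let the target concept be $\prod_{i=1}^k c_i^*$ with $c_i^*\in C_i$. Then the algorithm $\mathcal A$ described in the context, which uses only membership queries to the target $\prod_{i=1}^k c_i^*$ and is given no positive example, will terminate after making $O\big(\max_i\{\#\mathrm{Mem}_i(c_i^* )\}^k\big)$ queries.
   Context: A concept class over a set $X$ is a set of subsets of $X$ (concepts). A membership query takes an element $x$, and the oracle says whether $x$ belongs to the target concept. $\prod S_i=S_1\times\cdots\times S_k$ is the Cartesian product. For a vector $\vec p$, $\vec p[i\leftarrow y]$ denotes $\vec p$ with its $i$-th entry replaced by $y$. For each $i$, let $(q^i_0,q^i_1,\dots)$ be the elements of $X_i$ whose membership $A_i$ would query if it received only negative answers. If this sequence is finite, let $N_i\in C_i$ be the concept $A_i$ outputs after receiving negative answers to all of these queries, and let $n_i$ be a fixed element of $N_i$. If the sequence is infinite, $N_i$ and $n_i$ do not exist. The algorithm $\mathcal A$ is the following. Initialisation: for each $i$, set $S_i:=\{n_i\}$ if $N_i$ and $n_i$ exist, and $S_i:=\emptyset$ otherwise; set $j:=0$. While some $A_i$ has not terminated, do the following. (a) For each $i=1,\dots,k$ such that $A_i$ has not terminated, get the query $q^i_j$ from $A_i$, pass the answer `no' to $A_i$, and set $S_i:=S_i\cup\{q^i_j\}$. (b) For each $\vec x\in\prod S_i$, query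 whether $\vec x\in\prod c_i^*$; if the answer is yes, run the procedure $\mathcal P$ below with $\vec p:=\vec x$ and finish. (c) Set $j:=j+1$. Procedure $\mathcal P$ (learning from membership queries and one positive example $\vec p\in\prod c_i^*$): simulate $A_1,\dots,A_k$ in sequence, moving on to $A_{i+1}$ once $A_i$ returns a hypothesis $c_i$. Whenever $A_i$ asks a membership query for $y\in X_i$, query whether $\vec p[i\leftarrow y]\in\prod c_i^*$ and pass this answer to $A_i$. At the end, return $\prod c_i$.
   Formalization: In step (b) a vector already queried in an earlier round is not queried again; if every round re-queried all of the product of the S_i and repeats were counted, the stated bound would fail (k = 1, singletons of the natural numbers). *)

(* Defs.v *)
From mathcomp Require Import all_boot.
From mathcomp Require Import boolp classical_sets functions cardinality.
From Stdlib Require List.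

Set Implicit Arguments.
Unset Strict Implicit.
Unset Printing Implicit Defensive.

Local Open Scope classical_set_scope.

(* A deterministic membership-query learner, seen as an interaction tree: it
   either outputs a result or asks for the membership of an element and goes on
   according to the answer.  The tree is coinductive because a learner may go
   on asking forever on answers that fit no concept of its class. *)
CoInductive learner (X R : Type) : Type :=
| Output of R
| Query of X & (bool -> learner X R).
Arguments Output {X R} _.
Arguments Query {X R} _ _.

(* [learner_run c A qs r]: with a membership oracle for [c], [A] makes exactly
   the oracle calls [qs], in this order and with repetitions, and outputs [r]. *)
Inductive learner_run (X R : Type) (c : set X) :
    learner X R -> seq X -> R -> Prop :=
| run_output r : learner_run c (Output r) [::] r
| run_query x next qs r :
    learner_run c (next `[< c x >]) qs r ->
    learner_run c (Query x next) (x :: qs) r.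

Definition learns_with (X : Type) (A : learner X (set X)) (c : set X) (m : nat)
  : Prop := exists2 qs, learner_run c A qs c & size qs = m.

(* Against [set0] every answer is negative, so this says that the sequence of
   queries made by [A] on negative answers is finite and that [A] then
   outputs [N]. *)
Definition negative_output (X : Type) (A : learner X (set X)) (N : set X)
  : Prop := exists qs, learner_run set0 A qs N.

Definition negative_witness (X : Type) (A : learner X (set X)) (n : option X)
  : Prop :=
  if n is Some y then exists2 N, negative_output A N & N y
  else forall N, ~ negative_output A N.

Definition halted (X R : Type) (A : learner X R) : bool :=
  if A is Output _ then true else false.

Definition pending (X R : Type) (A : learner X R) : set X :=
  if A is Query x _ then [set x] else set0.

Definition answer_no (X R : Type) (A : learner X R) : learner X R :=
  if A is Query _ next then next false else A.

(* Same as [learner], with silent steps: a while loop may complete rounds in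
   which it makes no oracle call. *)
CoInductive algorithm (X R : Type) : Type :=
| Return of R
| Ask of X & (bool -> algorithm X R)
| Silent of algorithm X R.
Arguments Return {X R} _.
Arguments Ask {X R} _ _.
Arguments Silent {X R} _.

Inductive algorithm_run (X R : Type) (c : set X) :
    algorithm X R -> seq X -> R -> Prop :=
| run_return r : algorithm_run c (Return r) [::] r
| run_ask x next qs r :
    algorithm_run c (next `[< c x >]) qs r ->
    algorithm_run c (Ask x next) (x :: qs) r
| run_silent a qs r :
    algorithm_run c a qs r -> algorithm_run c (Silent a) qs r.

CoFixpoint simulate (Y X R R' : Type) (f : Y -> X) (A : learner Y R)
    (continue : R -> algorithm X R') : algorithm X R' :=
  match A with
  | Output r => Silent (continue r)
  | Query y next => Ask (f y) (fun b => simulate f (next b) continue)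
  end.

Section Product.
Variables (k : nat) (X : 'I_k -> Type).

Definition vector : Type := forall i, X i.

Definition product (S : forall i, set (X i)) : set vector :=
  [set x | forall i, S i (x i)].

(* The order in which a finite product is scanned is left unspecified. *)
Definition product_listing (listing : (forall i, set (X i)) -> seq vector)
  : Prop :=
  forall S, (forall i, finite_set (S i)) ->
  forall x, List.In x (listing S) <-> product S x.

Lemma finite_product (S : forall i, set (X i)) :
  (forall i, finite_set (S i)) -> finite_set (product S).
Proof.
move=> fS; have [[b Sb]|S0] := pselect (exists b, product S b); last first.
  by apply: (@sub_finite_set _ _ set0) => // x Sx; case: S0; exists x.
have fin (r : seq 'I_k) :
    finite_set [set x | product S x /\ forall i, i \notin r -> x i = b i].
  elim: r => [|i r IHr].
    apply: (@sub_finite_set _ _ [set b]); last exact: finite_set1.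
    by move=> x [_ xb]; apply: functional_extensionality_dep => i; exact: xb.
  apply: sub_finite_set (finite_image2 (fun f (y : X i) => dfwith f y)
    IHr (fS i)) => x [Sx xb].
  exists (dfwith x (b i)); last exists (x i) => //.
    split=> j; first by case: dfwithP.
    case: dfwithP => // j' ij' jr.
    by rewrite xb // inE negb_or jr andbT eq_sym.
  apply: functional_extensionality_dep => j.
  by case: dfwithP => // j' ij'; rewrite dfwith_out.
apply: sub_finite_set (fin (enum 'I_k)) => x Sx; split=> // i.
by rewrite mem_enum.
Qed.

Lemma product_listing_exists : exists listing, product_listing listing.
Proof.
suff H (S : forall i, set (X i)) : {l : seq vector |
    (forall i, finite_set (S i)) -> forall x, List.In x l <-> product S x}.
  by exists (fun S => sval (H S)) => S; exact: svalP (H S).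
apply: cid.
have [fS|] := pselect (forall i, finite_set (S i)); last by exists [::].
have /(@finite_seqP {classic vector})[l lE] := finite_product fS.
exists l => _ x; rewrite lE /=.
elim: l {lE} => [|y l IHl] //=; rewrite inE; split.
  by case=> [->|/IHl ->]; rewrite ?eqxx ?orbT.
by case/orP => [/eqP ->|/IHl]; [left|right].
Qed.

Variable A : forall i, learner (X i) (set (X i)).

(* [dfwith p y], for [y : X i], is p[i <- y].  [h] accumulates the hypotheses
   of the learners simulated so far. *)
Fixpoint learn_each (p : vector) (s : seq 'I_k) (h : forall i, set (X i))
  : algorithm vector (option (set vector)) :=
  if s is i :: s' then
    simulate (fun y : X i => dfwith p y) (A i)
      (fun c => learn_each p s' (dfwith h c))
  else Return (Some (product h)).

Definition learn_from_positive (p : vector) : algorithm vector (option (set vector)) :=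
  learn_each p (enum 'I_k) (fun=> set0).

Variable listing : (forall i, set (X i)) -> seq vector.

(* [todo] is what is left to scan of the current product, [asked] the set of
   vectors queried so far (all of them answered negatively), [B i] the current
   state of the i-th learner.  The oracle is not called again on a vector whose
   answer is already known; re-asking the whole product in every round would
   cost a further factor of the order of the number of rounds.  If the loop
   ends without a positive example, what has to be returned is not specified
   and [None] is returned. *)
CoFixpoint search (todo : seq vector) (asked : set vector)
    (B : forall i, learner (X i) (set (X i))) (S : forall i, set (X i))
  : algorithm vector (option (set vector)) :=
  match todo with
  | x :: todo' =>
      if `[< asked x >] then Silent (search todo' asked B S)
      else Ask x (fun b => if b then learn_from_positive x else search todo' (x |` asked) B S)
  | [::] =>
      if [forall i, halted (B i)] then Return None
      else
        let S' := fun i => S i `|` pending (B i) in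
        Silent (search (listing S') asked (fun i => answer_no (B i)) S')
  end.

Definition cartesian_learner (n : forall i, option (X i))
  : algorithm vector (option (set vector)) :=
  search [::] set0 A (fun i => [set y | n i = Some y]).
End Product.

(* Main.v *)
(* Let M be the largest number of queries the learners make on their targets.
   On its target c_i^*, the learner A_i either receives a positive answer within
   M queries, or behaves as on negative answers only, so that N_i = c_i^* and
   n_i is positive.  Hence after M rounds every S_i has a positive element and
   the search has succeeded (or the learners have all halted).  Until then
   #|S_i| <= M + 1, so at most (M + 1)^k <= 2^k M^k distinct vectors are
   queried, and the procedure P adds at most k M queries. *)
Require Import Defs.
From mathcomp Require Import all_boot.
From mathcomp Require Import boolp classical_sets functions cardinality.

Set Implicit Arguments.
Unset Strict Implicit.
Unset Printing Implicit Defensive.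

Local Open Scope classical_set_scope.

(* Matching on an algorithm forces the unfolding of a cofixpoint. *)
Lemma algorithm_eta (X R : Type) (a : algorithm X R) :
  a = match a with
      | Return r => Return r
      | Ask x next => Ask x next
      | Silent a' => Silent a'
      end.
Proof. by case: a. Qed.

(** * Single learners and their simulation *)

Section Learner.
Variables X R : Type.
Implicit Types (A : learner X R) (c : set X).

Definition next_query A : option X := if A is Query x _ then Some x else None.

Lemma pendingE A : pending A = [set y | next_query A = Some y].
Proof.
by case: A => [r|x next]; apply/seteqP; split=> y //= => [->|[]].
Qed.

Lemma learner_run_inj c A qs r qs' r' :
  learner_run c A qs r -> learner_run c A qs' r' -> r = r'.
Proof.
move=> Ar; elim: Ar qs' r' => {A qs r} [r|x next qs r _ IH] qs' r' Ar'.
  by inversion Ar'.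
by inversion Ar'; subst; apply: IH; eassumption.
Qed.

(** Up to its first positive answer, a run against [c] coincides with the run on negative answers;
    [j] counts the answers before that positive one. *)
Lemma learner_run_negative_or_hit c A qs r : learner_run c A qs r ->
  learner_run set0 A qs r \/
  exists2 j, j < size qs
    & exists2 y, next_query (iter j (@answer_no X R) A) = Some y & c y.
Proof.
elim=> {A qs r} [r|x next qs r _ IH]; first by left; exact: run_output.
have [cx|ncx] := pselect (c x); first by right; exists 0 => //; exists x.
move: IH; rewrite (asboolF ncx) => -[run0|[j jqs hit]].
  by left; apply: run_query; rewrite asboolF.
by right; exists j.+1; rewrite ?ltnS // iterSr.
Qed.

(** The pullback of [T] along [f] is [c], so the simulated learner receives the answers of an oracle
    for [c]. *)
Lemma simulate_run (Y R' : Type) (f : X -> Y) (A : learner X R)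
    (continue : R -> algorithm Y R') (T : set Y) c qs r qs' out :
  (forall y, T (f y) = c y) -> learner_run c A qs r ->
  algorithm_run T (continue r) qs' out ->
  algorithm_run T (simulate f A continue) (map f qs ++ qs') out.
Proof.
move=> Tf; elim=> {A qs r} [r|x next qs r _ IH] run'.
  by rewrite (algorithm_eta (simulate _ _ _)); exact: run_silent.
rewrite (algorithm_eta (simulate _ _ _)) /=; apply: run_ask.
by rewrite Tf; exact: IH.
Qed.

End Learner.

Section CartesianLearner.
Variables (k : nat) (X : 'I_k -> Type) (A : forall i, learner (X i) (set (X i))).
Variables (cstar : forall i, set (X i)) (M : nat).
Arguments cstar : clear implicits.
Hypothesis A_learns :
  forall i, exists2 qs, learner_run (cstar i) (A i) qs (cstar i) & size qs <= M.

Lemma product_dfwith (p : vector X) i (y : X i) :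
  product cstar p -> product cstar (dfwith p y) = cstar i y.
Proof.
move=> pP; apply/propext; split=> [/(_ i)|cy j]; first by rewrite dfwith_in.
by case: dfwithP.
Qed.

Lemma learn_each_run (p : vector X) s h : product cstar p ->
  exists qs out, algorithm_run (product cstar) (learn_each A p s h) qs out /\
    size qs <= size s * M.
Proof.
move=> pP; elim: s h => [|i s IHs] h.
  by exists [::], (Some (product h)); split=> //; exact: run_return.
have [qs Aqs sqs] := A_learns i.
have [qs' [out [run' sqs']]] := IHs (dfwith h (cstar i)).
exists (map (fun y : X i => dfwith p y) qs ++ qs'), out; split.
  by apply: simulate_run Aqs run' => y; exact: product_dfwith.
by rewrite size_cat size_map mulSn leq_add.
Qed.

(** * Candidate entries of a positive vector *)

Variable n : forall i, option (X i).
Hypothesis n_witness : forall i, negative_witness (A i) (n i).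

Definition state (j : nat) i : learner (X i) (set (X i)) :=
  iter j (@answer_no _ _) (A i).

(* [candidate i t.+1] is q^i_t, and [candidate i 0] is n_i. *)
Definition candidate i (t : nat) : option (X i) :=
  if t is t'.+1 then next_query (state t' i) else n i.

(** The value of $S_i$ after [j] rounds; [t = j] is included because position 0 is taken by
    $n_i$. *)
Definition candidates (j : nat) i : set (X i) :=
  [set y | exists2 t, t <= j & candidate i t = Some y].
Arguments candidates : clear implicits.

Lemma candidates0 : candidates 0 = fun i => [set y | n i = Some y].
Proof.
apply: functional_extensionality_dep => i; apply/seteqP; split=> y /=.
  by case=> t; rewrite leqn0 => /eqP ->.
by exists 0.
Qed.

Lemma candidatesS j :
  candidates j.+1 = fun i => candidates j i `|` pending (state j i).
Proof.
apply: functional_extensionality_dep => i; rewrite pendingE.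
apply/seteqP; split=> y /=.
  case=> t; rewrite leq_eqVlt => /orP[/eqP -> ?|]; first by right.
  by rewrite ltnS => tj ty; left; exists t.
case=> [[t tj ty]|jy]; last by exists j.+1.
by exists t; first exact: leqW.
Qed.

Lemma finite_candidates j i : finite_set (candidates j i).
Proof.
have fin (o : option (X i)) : finite_set [set y | o = Some y].
  case: o => [x|]; last by apply: (@sub_finite_set _ _ set0).
  by apply: sub_finite_set (finite_set1 x) => y /= [->].
elim: j => [|j IHj]; first by rewrite candidates0; exact: fin.
by rewrite candidatesS finite_setU pendingE; split.
Qed.

Lemma positive_candidates :
  exists x, product (candidates M) x /\ product cstar x.
Proof.
suff /fin_all_exists[x xP] : forall i, exists y, candidates M i y /\ cstar i y.
  by exists x; split=> i; have [] := xP i.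
move=> i; have [qs Aqs sqs] := A_learns i.
have [run0|[j jqs [y jy cy]]] := learner_run_negative_or_hit Aqs; last first.
  by exists y; split=> //; exists j.+1 => //; exact: leq_trans jqs sqs.
have := n_witness i; case ni: (n i) => [y|] /=; last first.
  by case/(_ (cstar i)); exists qs.
case=> N [qs' runN] Ny; exists y; split; first by exists 0.
by rewrite (learner_run_inj run0 runN).
Qed.

(* A candidate vector is coded by the positions of its entries in the sequences
   of candidates. *)
Definition codes (f : {ffun 'I_k -> 'I_M.+1}) (x : vector X) : Prop :=
  forall i, candidate i (f i) = Some (x i).

Lemma codes_inj f x y : codes f x -> codes f y -> x = y.
Proof.
move=> fx fy; apply: functional_extensionality_dep => i.
by have := fx i; rewrite fy => -[].
Qed.

Lemma codes_exists j x : j <= M -> product (candidates j) x -> exists f, codes f x.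
Proof.
move=> jM xP.
suff /fin_all_exists[f fP] :
    forall i, exists t : 'I_M.+1, candidate i t = Some (x i).
  by exists (finfun f) => i; rewrite ffunE.
move=> i; have [t tj tx] := xP i.
have tM : t < M.+1 by rewrite ltnS (leq_trans tj).
by exists (Ordinal tM).
Qed.

(** The potential that pays for the search. Codes are counted instead of vectors because they form a
    finite type with $(M+1)^k$ elements. *)
Definition unasked (asked : set (vector X)) : nat :=
  #|[pred f | `[< exists2 x, codes f x & ~ asked x >]]|.

Lemma unasked_le asked : unasked asked <= M.+1 ^ k.
Proof. by rewrite -[k]card_ord -[M.+1]card_ord -card_ffun max_card. Qed.

(** A code of [x] exists since [j <= M], and it leaves the count because it codes no other
    vector. *)
Lemma unaskedU1 asked j x : j <= M -> product (candidates j) x -> ~ asked x ->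
  unasked (x |` asked) < unasked asked.
Proof.
move=> jM xP nx; have [f fx] := codes_exists jM xP.
apply/proper_card/properP; split.
  apply/fintype.subsetP => g; rewrite !inE => -[y gy ny].
  by exists y => // ay; apply: ny; right.
exists f; rewrite inE; first by exists x.
by apply/asboolP => -[y fy]; rewrite (codes_inj fy fx); case; left.
Qed.

(** * The search loop *)

Variable listing : (forall i, set (X i)) -> seq (vector X).
Hypothesis listingP : product_listing listing.

Lemma all_halted : M = 0 -> [forall i, halted (A i)].
Proof.
move=> M0; apply/forallP => i; have [[|x qs] Aqs] := A_learns i.
  by inversion Aqs.
by rewrite M0.
Qed.

(* [d] is the number of rounds left.  No product has been scanned yet at
   [j = 0], whence the guard in the last hypothesis. *)
Lemma search_run d j todo asked : j + d = M ->
  (forall x, List.In x todo -> product (candidates j) x) ->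
  (forall x, asked x -> ~ product cstar x) ->
  (0 < j -> forall x, product (candidates j) x -> List.In x todo \/ asked x) ->
  exists qs out,
    algorithm_run (product cstar)
      (search A listing todo asked (state j) (candidates j)) qs out /\
    size qs <= unasked asked + k * M.
Proof.
elim/ltn_ind: d j todo asked => d IHd j todo asked jd.
have jM : j <= M by rewrite -jd leq_addr.
(* Four cases: the loop ends, a new round starts, [x] was asked before, [x] is new. *)
elim: todo asked => [|x todo IHtodo] asked todoP askedN cover;
  rewrite (algorithm_eta (search _ _ _ _ _ _)) /=; case: ifP => [|running].
- by exists [::], None; split=> //; exact: run_return.
- case: d => [|d] in IHd jd *.
    (* No round can follow round [M]: a positive vector of the scanned product would have been
       answered negatively. *)
    move: jd; rewrite addn0 => jM'; subst j.
    have [M0|/cover askedP] := posnP M.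
      by move: running; rewrite M0 all_halted.
    have [x [xP cx]] := positive_candidates.
    by have [//|/askedN] := askedP x xP.
  rewrite -candidatesS; have S'P := listingP (finite_candidates j.+1).
  have [||//||qs [out [run sqs]]] :=
    IHd d (ltnSn d) j.+1 (listing (candidates j.+1)) asked.
  + by rewrite addSnnS.
  + by move=> x /S'P.
  + by move=> _ x /S'P; left.
  by exists qs, out; split=> //; exact: run_silent.
- move=> /asboolW ax; have [|//||qs [out [run sqs]]] := IHtodo asked.
  + by move=> y ytodo; apply: todoP; right.
  + by move=> j0 y /(cover j0)[[<-|]|]; [right|left|right].
  by exists qs, out; split=> //; exact: run_silent.
have nx : ~ asked x by apply/asboolPn; rewrite running.
have [cx|ncx] := pselect (product cstar x).
  have [qs [out [run sqs]]] := learn_each_run (enum 'I_k) (fun=> set0) cx.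
  exists (x :: qs), out; split.
    by apply: run_ask; rewrite asboolT.
  have xP : product (candidates j) x by apply: todoP; left.
  (* The potential is still positive and pays for [x]; [k * M] pays for $\mathcal P$. *)
  apply: (leq_add (leq_ltn_trans (leq0n _) (unaskedU1 jM xP nx))).
  by rewrite -[k in k * M]size_enum_ord.
have [|||qs [out [run sqs]]] := IHtodo (x |` asked).
- by move=> y ytodo; apply: todoP; right.
- by move=> y [->|/askedN].
- by move=> j0 y /(cover j0)[[<-|]|]; [right; left|left|right; right].
exists (x :: qs), out; split; first by apply: run_ask; rewrite asboolF.
apply: leq_trans (leq_add (unaskedU1 jM (todoP x _) nx) (leqnn _)); last by left.
by rewrite addSn ltnS.
Qed.

End CartesianLearner.

Theorem proposition6 (k : nat) :
  exists K : nat,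
  forall (X : 'I_k -> Type) (C : forall i, set (set (X i)))
    (A : forall i, learner (X i) (set (X i)))
    (Mem : forall i, set (X i) -> nat)
    (n : forall i, option (X i))
    (listing : (forall i, set (X i)) -> seq (vector X))
    (cstar : forall i, set (X i)),
  (forall i, ~ C i set0) ->
  (forall i c, C i c -> learns_with (A i) c (Mem i c)) ->
  (forall i N, negative_output (A i) N -> C i N) ->
  (forall i, negative_witness (A i) (n i)) ->
  product_listing listing ->
  (forall i, C i (cstar i)) ->
  exists qs out,
    algorithm_run (product cstar) (cartesian_learner A listing n) qs out /\
    size qs <= K * (\max_(i < k) Mem i (cstar i)) ^ k.
Proof.
exists (2 ^ k + k) => X C A Mem n listing cstar _ A_learns _ n_witness
  listingP cstarP.
set M := \max_(i < k) _.
have A_learnsM i :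
    exists2 qs, learner_run (cstar i) (A i) qs (cstar i) & size qs <= M.
  have [qs Aqs sqs] := A_learns i _ (cstarP i).
  by exists qs => //; rewrite sqs; exact: leq_bigmax.
(* For [M = 0] the bound vanishes when [k > 0], so it must be shown that nothing is asked. For
   [M > 0], $M+1\le 2M$ gives the summand [2 ^ k]. *)
have [M0|M_gt0] := posnP M.
  exists [::], None; split=> //.
  rewrite (algorithm_eta (cartesian_learner _ _ _)) /=.
  by rewrite (all_halted A_learnsM M0); exact: run_return.
have [//|//|//|//|qs [out [run sqs]]] :=
  @search_run _ _ A cstar M A_learnsM n n_witness listing listingP M 0 [::] set0.
exists qs, out; split; first by rewrite candidates0 in run.
apply: leq_trans sqs _; rewrite mulnDl -expnMn leq_add //.
  apply: leq_trans (unasked_le _ _ _ _) _.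
  have [->//|k_gt0] := posnP k.
  by rewrite leq_exp2r // mul2n -addnn -add1n leq_add2r.
rewrite leq_mul2l; have [//|k_gt0] := posnP k.
by rewrite -{1}[M]expn1 leq_pexp2l ?orbT.
Qed.
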